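(* Let $A$ be a perfect evolution algebra of finite dimension $n\geq 1$ over a field $\mathbb K$. Then $A$ contains a maximal $i$-basic ideal for some $i\in\{0,1,\dots,n-1\}$.
   Context: An evolution algebra over a field $\mathbb K$ is a (not necessarily associative) $\mathbb K$-algebra $A$ having a basis $B=\{e_j \mid j\in\Lambda\}$ with $e_je_k=0$ whenever $j\neq k$; such a basis is called a natural basis. $A$ is perfect if $A^2=A$, where $A^2$ is the linear span of all products. A proper ideal $I$ of $A$ is an $i$-basic ideal relative to a natural basis $B$ if $I$ is the linear span of $i$ vectors of $B$ (so $\dim I=i$; the zero ideal is the $0$-basic ideal); a basic ideal relative to $B$ is an ideal that is $i$-basic relative to $B$ for some $i$. $I$ is a maximal $i$-basic ideal relative to $B$ if it is $i$-basic relative to $B$ and there are no basic ideals relative to $B$ of dimension $j>i$. For a perfect finite-dimensional $A$, $I$ is called an $i$-basic ideal (respectively a maximal $i$-basic ideal) if it is so relative to every natural basis of $A$. *)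

(* Defs.v *)
From HB Require Import structures.
From mathcomp Require Import all_boot all_order all_algebra.

Set Implicit Arguments.
Unset Strict Implicit.
Unset Printing Implicit Defensive.

Import GRing.Theory.
Local Open Scope ring_scope.

(* A finite-dimensional, not necessarily associative K-algebra is a            *)
(* [vectType K] together with a bilinear product [mul].                        *)
Section EvolutionAlgebras.

Variables (K : fieldType) (A : vectType K) (mul : {bilinear A -> A -> A}).

(* A finite basis is given as a sequence; none of the notions below depends on *)
(* the order in which its vectors are listed.                                  *)
Definition natural_basis (B : seq A) : Prop :=
  basis_of fullv B /\ {in B &, forall e f, e != f -> mul e f = 0}.

Definition evolution_algebra : Prop := exists B : seq A, natural_basis B.

(* Membership in A^2, i.e. in the linear span of all products: [x] is a linear *)
(* combination of finitely many products.                                      *)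
Definition in_square (x : A) : Prop :=
  exists s : seq (A * A), x \in <<[seq mul p.1 p.2 | p <- s]>>%VS.

Definition perfect : Prop := forall x : A, in_square x.

Definition ideal (I : {vspace A}) : Prop :=
  forall x a : A, x \in I -> mul a x \in I /\ mul x a \in I.

Definition proper_ideal (I : {vspace A}) : Prop := ideal I /\ I <> fullv.

Definition basic_ideal_rel (i : nat) (B : seq A) (I : {vspace A}) : Prop :=
  proper_ideal I /\
  exists S : seq A, [/\ uniq S, {subset S <= B}, size S = i & I = <<S>>%VS].

Definition maximal_basic_ideal_rel (i : nat) (B : seq A) (I : {vspace A}) :
    Prop :=
  basic_ideal_rel i B I /\
  ~ (exists (j : nat) (J : {vspace A}), (i < j)%N /\ basic_ideal_rel j B J).

Definition maximal_basic_ideal (i : nat) (I : {vspace A}) : Prop :=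
  forall B : seq A, natural_basis B -> maximal_basic_ideal_rel i B I.

End EvolutionAlgebras.

(* Main.v *)
Require Import Defs.
From HB Require Import structures.
From mathcomp Require Import all_boot all_order all_algebra.
From Stdlib Require Import Classical_Prop.

Local Open Scope ring_scope.

(** Up to order and nonzero scalars, a perfect finite-dimensional evolution
    algebra has only one natural basis, so being a basic ideal does not depend
    on the natural basis, and a basic ideal of largest dimension relative to
    one natural basis (the zero ideal is a candidate since n >= 1) is maximal
    relative to all of them.

    For the uniqueness, let B be a natural basis. If v has coordinate k at
    e in B, then e v = v e = k e^2 ([natural_coords]). Hence the squares e^2
    span A^2 = A, and, being as many as the dimension, they are independent
    ([free_squares]). Let f belong to a second natural basis. If e in B has a
    nonzero coordinate k in f, then computing e f in both bases gives
    k e^2 = h f^2, where h is the coordinate of e at f, so e^2 lies on the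
    line of f^2. Two distinct such e would contradict the independence of the
    squares, and f <> 0 has at least one; so f is a multiple of a single
    vector of B ([natural_basis_line]). *)

Section PerfectEvolutionAlgebra.

Set Implicit Arguments.
Unset Strict Implicit.
Unset Printing Implicit Defensive.

Import GRing.Theory.

Variables (K : fieldType) (A : vectType K) (mul : {bilinear A -> A -> A}).

Implicit Types (B S : seq A) (I J : {vspace A}).

Lemma natural_basis_size B : natural_basis mul B -> size B = \dim {:A}.
Proof.
by case=> basisB _; rewrite -(span_basis basisB) (eqP (basis_free basisB)).
Qed.

(** Orthogonality of distinct basis vectors leaves only the diagonal term when
    a vector is multiplied by a basis vector. *)
Lemma natural_coords B (v : A) : natural_basis mul B ->
  exists2 k : A -> K, v = \sum_(e <- B) k e *: e &
    {in B, forall e,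
       mul e v = k e *: mul e e /\ mul v e = k e *: mul e e}.
Proof.
case=> basisB orthB; have freeB := basis_free basisB.
have /(free_span freeB)[k defv _] : v \in <<B>>%VS.
  by rewrite (span_basis basisB) memvf.
exists k => // e eB; split; rewrite defv.
  rewrite linear_sumr (bigD1_seq e) ?free_uniq //= linearZr_LR /=.
  rewrite big_seq_cond big1 ?addr0 // => x /andP[xB ne_xe].
  by rewrite linearZr_LR /= orthB ?scaler0 // eq_sym.
rewrite linear_sumlz (bigD1_seq e) ?free_uniq //= linearZl_LR /=.
rewrite big_seq_cond big1 ?addr0 // => x /andP[xB ne_xe].
by rewrite linearZl_LR /= orthB ?scaler0.
Qed.

Lemma mul_in_span_squares B (u v : A) : natural_basis mul B ->
  mul u v \in <<[seq mul e e | e <- B]>>%VS.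
Proof.
move=> natB; have [k -> _] := natural_coords v natB.
have [h _ mulu] := natural_coords u natB.
rewrite linear_sumr big_seq; apply: memv_suml => e eB /=.
rewrite linearZr_LR /= (proj2 (mulu e eB)) !memvZ //.
by apply: memv_span; apply: map_f.
Qed.

(** The squares span A by perfection and are as numerous as its dimension. *)
Lemma free_squares B : perfect mul -> natural_basis mul B ->
  free [seq mul e e | e <- B].
Proof.
move=> perfA natB; apply: (@basis_free _ _ fullv).
rewrite basisEdim size_map (natural_basis_size natB) leqnn andbT.
apply/subvP => x _; have [s] := perfA x; apply: subvP.
by apply/span_subvP => _ /mapP[p _ ->]; apply: mul_in_span_squares.
Qed.

Lemma squares_on_line_eq B (w : A) : perfect mul -> natural_basis mul B ->
  {in B &, forall e e', mul e e \in <[w]>%VS -> mul e' e' \in <[w]>%VS ->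
    e = e'}.
Proof.
move=> perfA natB e e' eB e'B ew e'w; apply/eqP/contraT => ne.
have e'B' : e' \in rem e B.
  by rewrite (rem_filter _ (free_uniq (basis_free natB.1))) mem_filter /= eq_sym ne.
(* With e and e' listed first, their squares form a free pair, too large for a
   line. *)
have permB : perm_eq B ([:: e; e'] ++ rem e' (rem e B)).
  by rewrite (perm_trans (perm_to_rem eB)) // perm_cons perm_to_rem.
have := free_squares perfA natB.
rewrite (perm_free (perm_map _ permB)) map_cat => /catl_free/eqP /= dim2.
have : (<<[:: mul e e; mul e' e']>> <= <[w]>)%VS.
  by apply/span_subvP => x; rewrite !inE => /orP[] /eqP->.
by move/dimvS; rewrite dim2 dim_vline; case: (w != 0).
Qed.

(** Uniqueness of the natural basis up to scalars: the product e f, expanded in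
    each of the two bases, puts on the line of f^2 the square of every e in B
    that occurs in f, and a line contains only one of the independent squares. *)
Lemma natural_basis_line B B' (f : A) :
    perfect mul -> natural_basis mul B -> natural_basis mul B' -> f \in B' ->
  exists2 e, e \in B & <[f]>%VS = <[e]>%VS.
Proof.
move=> perfA natB natB' fB'.
have [k deff mulf] := natural_coords f natB.
have sq_line e : e \in B -> k e != 0 -> mul e e \in <[mul f f]>%VS.
  move=> eB ke; have [h _ mule] := natural_coords e natB'.
  have := proj1 (mulf e eB); rewrite (proj2 (mule f fB')) => eq_sq.
  by rewrite -[mul e e](scalerK ke) -eq_sq !memvZ // memv_line.
have nzf : f != 0 by apply: (free_not0 (basis_free natB'.1)).
have /hasP[e eB ke] : has (fun e => k e != 0) B.
  apply: contraNT nzf => /hasPn k0; rewrite deff big_seq big1 // => e /k0.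
  by rewrite negbK => /eqP->; rewrite scale0r.
have -> : f = k e *: e; last first.
  exists e => //; apply/eqP; rewrite eqEsubv -!memvE memvZ ?memv_line //=.
  by rewrite -{1}[e](scalerK ke) memvZ // memv_line.
rewrite {1}deff (bigD1_seq e) ?(free_uniq (basis_free natB.1)) //=.
rewrite big_seq_cond big1 ?addr0 // => e' /andP[e'B ne].
have [->|ke'] := eqVneq (k e') 0; first by rewrite scale0r.
case/eqP: ne.
exact: (squares_on_line_eq perfA natB e'B eB (sq_line _ e'B ke')
  (sq_line _ eB ke)).
Qed.

(** Replacing each spanning vector by the vector of B on the same line keeps
    the ideal. *)
Lemma basic_ideal_rel_transfer B B' i I :
    perfect mul -> natural_basis mul B -> natural_basis mul B' ->
  basic_ideal_rel mul i B' I -> basic_ideal_rel mul i B I.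
Proof.
move=> perfA natB natB' [propI [S' [uniqS' subS' sizeS' defI]]]; split=> //.
have freeS' : free S'.
  have freeB' := basis_free natB'.1.
  have permS' : perm_eq S' (filter (mem S') B').
    apply: uniq_perm; rewrite ?filter_uniq ?(free_uniq freeB') // => x.
    by rewrite mem_filter /= andb_idr // => /subS'.
  by rewrite (perm_free permS') filter_free.
have [S [subS sizeS eqS]] : exists S,
    [/\ {subset S <= B}, size S = size S' & <<S>>%VS = <<S'>>%VS].
  elim: S' subS' {uniqS' sizeS' defI freeS'} => [|f S' IH] subS'.
    by exists [::].
  have [|S [subS sizeS eqS]] := IH.
    by move=> x xS'; apply: subS'; rewrite inE xS' orbT.
  have [|e eB line] := natural_basis_line (f := f) perfA natB natB'.
    by apply: subS'; rewrite mem_head.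
  exists (e :: S); split; rewrite /= ?sizeS //.
    by move=> x; rewrite inE => /orP[/eqP-> //|/subS].
  by rewrite !span_cons line eqS.
exists S; split; rewrite ?sizeS ?eqS //.
(* S has no repetition since its span, that of the free S', has dimension
   size S. *)
by apply: free_uniq; rewrite /free eqS sizeS.
Qed.

Lemma basic_ideal_rel_ltn B i I : natural_basis mul B ->
  basic_ideal_rel mul i B I -> (i < \dim {:A})%N.
Proof.
move=> natB [[_ properI] [S [uniqS subS sizeS defI]]].
rewrite ltnNge; apply/negP => le_dim; apply: properI.
have [|_ eqSB] := uniq_min_size uniqS subS.
  by rewrite (natural_basis_size natB) sizeS.
by rewrite defI (eq_span eqSB) (span_basis natB.1).
Qed.

Lemma basic_ideal_rel0 B : (0 < \dim {:A})%N ->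
  basic_ideal_rel mul 0 B 0%VS.
Proof.
move=> dimA; split; last by exists [::]; split; rewrite ?span_nil.
split=> [x a|eq0]; last by rewrite -eq0 dimv0 in dimA.
by rewrite memv0 => /eqP->; rewrite linear0l linear0 mem0v.
Qed.

Lemma exists_maximal_basic_ideal_rel B : natural_basis mul B ->
    (0 < \dim {:A})%N ->
  exists i I, maximal_basic_ideal_rel mul i B I.
Proof.
move=> natB dimA; have := basic_ideal_rel0 B dimA.
(* Starting from the zero ideal, pass to a larger basic ideal as long as there
   is one; the number of vectors stays below the dimension. *)
move: 0%N (0%VS : {vspace A}) => i I.
have [m] := ubnP (\dim {:A} - i); elim: m i I => // m IHm i I lt_m basicI.
case: (classic (exists j J, (i < j)%N /\ basic_ideal_rel mul j B J)).
  case=> j [J [lt_ij basicJ]]; apply: IHm basicJ.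
  have lt_i := basic_ideal_rel_ltn natB basicI.
  by apply: leq_trans (ltn_sub2l lt_i lt_ij) _.
by move=> noJ; exists i, I.
Qed.

End PerfectEvolutionAlgebra.

Theorem lemma2p5 (K : fieldType) (A : vectType K)
    (mul : {bilinear A -> A -> A}) (n : nat)
    (evA : evolution_algebra mul) (perfA : perfect mul)
    (dimA : \dim {:A} = n) (n_ge1 : (1 <= n)%N) :
  exists2 i : nat, (i <= n - 1)%N &
    exists I : {vspace A}, maximal_basic_ideal mul i I.
Proof.
have [B natB] := evA; rewrite -dimA in n_ge1 *.
have [i [I [basicI maxI]]] := exists_maximal_basic_ideal_rel natB n_ge1.
exists i; first by rewrite leq_subRL // add1n (basic_ideal_rel_ltn natB basicI).
exists I => B' natB'; split; first exact: basic_ideal_rel_transfer basicI.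
case=> j [J [lt_ij basicJ]]; apply: maxI; exists j, J; split=> //.
exact: basic_ideal_rel_transfer basicJ.
Qed.
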